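(* Let $X$ be the (finite or countable) vertex set of a graph and let $P$ be an irreducible random walk on $X$, with $1$-step transition probabilities $p(x,y)$, such that the associated transition operator $P$ is a compact operator from $l^\infty(X)$ into itself. Then $P$ is recurrent.
   Context: A random walk $(X,P)$ is a time-homogeneous Markov chain $\{Z_n\}_{n \in \mathbb{N}}$ with finite or countable state space $X$ and $1$-step transition probabilities $p(x,y) = \mathbb{P}[Z_1 = y \mid Z_0 = x]$, so $p(x,y) \ge 0$ and $\sum_{y \in X} p(x,y) = 1$ for every $x \in X$. It is irreducible if for all $x,y \in X$ there is $n \in \mathbb{N}$ with $p^{(n)}(x,y) > 0$, where $p^{(n)}(x,y) = \mathbb{P}[Z_n = y \mid Z_0 = x]$. The associated transition operator is $(Pf)(x) := \sum_{y \in X} p(x,y) f(y)$ for $f \in l^\infty(X)$, where $l^\infty(X)$ is the Banach space of bounded (real or complex) functions on $X$ with the supremum norm. An irreducible random walk is recurrent if, for every (equivalently, some) $x \in X$, the chain started at $x$ returns to $x$ with probability $1$; equivalently $\sum_{n} p^{(n)}(x,x) = +\infty$. *)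

(* Defs.v *)
From HB Require Import structures.
From mathcomp Require Import all_boot all_order all_algebra.
From mathcomp Require Import all_classical all_reals all_analysis.
From mathcomp Require Import complex.
From mathcomp.analysis.showcase Require Import summability.

Set Implicit Arguments.
Unset Strict Implicit.
Unset Printing Implicit Defensive.

Import Order.TTheory GRing.Theory Num.Theory.
Import numFieldNormedType.Exports.

Local Open Scope classical_set_scope.
Local Open Scope ring_scope.

#[global] Existing Instance totally_filter.

Section RandomWalk.
Context (R : realType) (X : countType).
Context (d : measure_display) (Omega : measurableType d).

Definition stochastic (p : X -> X -> R) : Prop :=
  (forall x y, 0 <= p x y) /\
  (forall x, (\esum_(y in [set: X]) (p x y)%:E = 1)%E).

(* The event {Z_0 = s_0, ..., Z_n = s_n}. *)
Definition history (Z : nat -> Omega -> X) (n : nat) (s : nat -> X) :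
    set Omega :=
  [set w | forall k, (k <= n)%N -> Z k w = s k].

(* [Pr x] is the law of the chain given Z_0 = x.  The Markov property
     P_x[Z_{n+1} = s_{n+1} | Z_0 = s_0, ..., Z_n = s_n] = p(s_n, s_{n+1})
   is stated multiplied out, so that histories of probability 0, on which
   one cannot condition, impose nothing.  The state space X carries the
   discrete sigma-algebra. *)
Record random_walk (p : X -> X -> R) (Pr : X -> probability Omega R)
    (Z : nat -> Omega -> X) : Prop := RandomWalk {
  walk_stochastic : stochastic p ;
  walk_measurable : forall n (A : set X), measurable (Z n @^-1` A) ;
  walk_start : forall x, Pr x [set w | Z 0%N w = x] = 1%E ;
  walk_markov : forall x n (s : nat -> X),
    Pr x (history Z n.+1 s) = (Pr x (history Z n s) * (p (s n) (s n.+1))%:E)%E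
}.

Definition irreducible (Pr : X -> probability Omega R)
    (Z : nat -> Omega -> X) : Prop :=
  forall x y, exists n : nat, (0 < Pr x [set w | Z n w = y])%E.

Definition recurrent (Pr : X -> probability Omega R)
    (Z : nat -> Omega -> X) : Prop :=
  forall x, Pr x [set w | exists n, (0 < n)%N /\ Z n w = x] = 1%E.

End RandomWalk.

Section LInfinity.
Context (X : countType) (K : numFieldType).

(* l^oo(X) with scalars K, as a subset of the space of all functions X -> K
   under uniform convergence: the topology induced on the bounded functions
   is that of the supremum norm. *)
Definition linfty : set {uniform X -> K^o} := bounded_fun.

Definition linfty_bounded (B : set {uniform X -> K^o}) : Prop :=
  exists M : K, forall f, B f -> forall x, `|f x| <= M.

(* T maps bounded subsets of l^oo(X) to relatively compact subsets of l^oo(X);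
   in particular it maps l^oo(X) into itself. *)
Definition compact_operator
    (T : {uniform X -> K^o} -> {uniform X -> K^o}) : Prop :=
  forall B, B `<=` linfty -> linfty_bounded B ->
  exists C : set {uniform X -> K^o},
    [/\ compact C, C `<=` linfty & T @` B `<=` C].

(* (Pf)(x) = \sum_y p(x, y) f(y) as an unordered infinite sum in K; [emb]
   embeds the real transition probabilities into the scalars. *)
Definition transition_operator (R : realType) (emb : R -> K)
    (p : X -> X -> R) (f : {uniform X -> K^o}) : {uniform X -> K^o} :=
  fun x => summability.sum (fun y => (emb (p x y) * f y : K^o)).

End LInfinity.

Definition transition_operator_real (R : realType) (X : countType)
    (p : X -> X -> R) : {uniform X -> R^o} -> {uniform X -> R^o} :=
  transition_operator (fun r : R => r) p.

Definition transition_operator_complex (R : realType) (X : countType)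
    (p : X -> X -> R) : {uniform X -> R[i]^o} -> {uniform X -> R[i]^o} :=
  transition_operator (real_complex R) p.

(* Main.v *)
Require Import Defs.
From HB Require Import structures.
From mathcomp Require Import all_boot all_order all_algebra.
From mathcomp Require Import all_classical all_reals all_analysis.
From mathcomp Require Import complex finmap lra.
From mathcomp.analysis.showcase Require Import summability.

(** Why the theorem is true.

    Let g_n be the indicator function of the points of X whose rank in a fixed
    enumeration is at least n.  Then (P g_n)(x) is the mass that the
    distribution p(x, .) puts beyond rank n, and it tends to 0 for every
    fixed x.  The functions g_n form a bounded set, so a compact P sends them
    into a compact set, where the sequence P g_n has a uniform cluster point;
    by the pointwise limit this cluster point is 0.  Hence, for some N, P g_N
    is at most 1/2 everywhere: from every state, one step leads with
    probability at least 1/2 into the finite set F of the points of rank less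
    than N ([compact_operator_tight]).  The functions g_n are real, and the
    same argument serves both scalar fields.

    Fix x.  From each point of F other than x, irreducibility gives a positive
    probability to visit x before a certain time; as F is finite, one time and
    one lower bound are good for all of F ([avoid_finite_lt1]).  Moving first
    into F and then to x shows that, for some n and some c < 1, the
    probability to avoid x during n steps is at most c from every starting
    point ([avoid_uniform]).  By the Markov property it is at most c^k during
    n k steps ([avoid_geometric]), and so x is almost surely visited again.

    The Markov property is only given for single histories.  It is extended
    to all events of the past by summation over the countably many finite
    paths ([markov_past]), and then used in one form only: the probability to
    avoid x during n steps is the n-th iterate, applied to the constant 1, of
    the transition operator with the transitions into x removed
    ([avoid_iter]).  The contraction argument takes place on the side of this
    operator, which is monotone and homogeneous. *)

Set Implicit Arguments.
Unset Strict Implicit.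
Unset Printing Implicit Defensive.
Import Order.TTheory GRing.Theory Num.Theory.
Import numFieldNormedType.Exports.
Local Open Scope classical_set_scope.
Local Open Scope ring_scope.

(** * Tightness of a compact transition operator *)

Section UnorderedSums.
Context (R : realType) (I : choiceType).

Lemma fset_sum_le_esum (a : I -> R) (l : R) (B : {fset I}) :
  (\esum_(i in [set: I]) (a i)%:E = l%:E)%E -> \sum_(i <- B) a i <= l.
Proof.
move=> al; rewrite -lee_fin -al -sumEFin; apply: esum_ge.
exists [set` B]; first by split=> //; exact: finite_fset.
by rewrite fsbig_finite ?set_fsetK//; exact: finite_fset.
Qed.

Lemma fset_sum_approx_esum (a : I -> R) (l r : R) :
  (\esum_(i in [set: I]) (a i)%:E = l%:E)%E -> 0 < r ->
  exists B : {fset I}, l - r < \sum_(i <- B) a i.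
Proof.
move=> al r0.
have : ((l - r)%:E < \esum_(i in [set: I]) (a i)%:E)%E.
  by rewrite al lte_fin ltrBlDr ltrDl.
move=> /ereal_sup_gt[_ [A [finA _] <-]].
rewrite fsbig_finite// sumEFin lte_fin => lA.
by exists (fset_set A).
Qed.

Lemma fset_sum_le_subset (a : I -> R) (A B : {fset I}) :
  (forall i, 0 <= a i) -> (A `<=` B)%fset ->
  \sum_(i <- A) a i <= \sum_(i <- B) a i.
Proof.
move=> a0 AB; rewrite [leRHS](big_fsetID _ (mem A))/= -[leLHS]addr0.
apply: lerD; last by apply: sumr_ge0.
rewrite (_ : [fset _ | _ in _ & _]%fset = A)//.
apply/fsetP => i; rewrite !inE/=; apply/idP/idP => [/andP[]//|iA].
by rewrite (fsubsetP AB)//.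
Qed.

End UnorderedSums.

Section Tightness.
Context (R : realType) (X : countType) (K : numFieldType).
Context (emb : {rmorphism R -> K}).
(* Both scalar fields are treated at once: [emb] is the identity of R or the
   embedding of R into R[i].  Since the order of R[i] is partial, what is
   needed about its topology is that the positive reals are cofinal towards 0
   among the positive elements of K. *)
Hypothesis emb_mono : {mono emb : x y / x <= y}.
Hypothesis emb_small : forall e : K, 0 < e -> exists2 r : R, 0 < r & emb r <= e.

Lemma norm_emb (r : R) : 0 <= r -> `|emb r| = emb r.
Proof. by move=> r0; rewrite ger0_norm// -(rmorph0 emb) emb_mono. Qed.

(** For nonnegative real terms, the limit of the finite partial sums taken in K
    is the supremum of these sums taken in R. *)
Lemma sum_emb (a : X -> R) (l : R) : (forall y, 0 <= a y) ->
  (\esum_(y in [set: X]) (a y)%:E = l%:E)%E ->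
  summability.sum (fun y => emb (a y) : K^o) = emb l.
Proof.
move=> a0 al; apply: cvg_lim; first exact: norm_hausdorff.
apply/cvgrPdist_lt => e e0; have [r r0 re] := emb_small e0.
have [A lA] := fset_sum_approx_esum al r0.
exists A => // B /= AB.
rewrite /partial_sum -(big_seq_fsetE _ _ xpredT (fun y => emb (a y)))/=.
rewrite -rmorph_sum -rmorphB.
rewrite norm_emb ?subr_ge0 ?(fset_sum_le_esum _ al)//.
apply: lt_le_trans re; rewrite (leW_mono emb_mono).
by rewrite ltrBlDr -ltrBlDl (lt_le_trans lA)// fset_sum_le_subset.
Qed.

Context (p : X -> X -> R).
Hypothesis hp : stochastic p.

Definition tail_mass (n : nat) (x : X) : R :=
  fine (\esum_(y in [set y | (n <= choice.pickle y)%N]) (p x y)%:E).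

Definition tail_indicator (n : nat) : {uniform X -> K^o} :=
  fun y => (n <= choice.pickle y)%N%:R.

(** Written as a sum over all of X, the tail mass is the value of the transition
    operator at the indicator of the tail; this also shows its finiteness,
    without which [fine] would lose information. *)
Lemma tail_massE n x :
  (\esum_(y in [set: X]) (p x y * (n <= choice.pickle y)%N%:R)%:E =
   (tail_mass n x)%:E)%E.
Proof.
rewrite (_ : esum _ _ =
  \esum_(y in [set y | (n <= choice.pickle y)%N]) (p x y)%:E)%E; last first.
  rewrite [RHS]esum_mkcond; apply: eq_esum => y _.
  case: ifPn => [/set_mem/= ->|]; first by rewrite mulr1.
  by rewrite notin_setE/= => /negP/negbTE ->; rewrite mulr0.
rewrite fineK// ge0_fin_numE; last by apply: esum_ge0 => y _; rewrite lee_fin hp.1.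
apply: (@le_lt_trans _ _ 1%E); last by rewrite ltry.
rewrite -(hp.2 x) [leLHS]esum_mkcond; apply: le_esum => y _.
by case: ifP => // _; rewrite lee_fin hp.1.
Qed.

Lemma tail_mass_ge0 n x : 0 <= tail_mass n x.
Proof. by apply: fine_ge0; apply: esum_ge0 => y _; rewrite lee_fin hp.1. Qed.

Lemma tail_mass_le n x (J : {fset X}) :
  (forall y, y \in J -> (choice.pickle y < n)%N) ->
  tail_mass n x <= 1 - \sum_(y <- J) p x y.
Proof.
move=> Jn; rewrite lerBrDl -lee_fin EFinD -tail_massE -(hp.2 x).
rewrite -sumEFin.
have -> : (\sum_(y <- J) (p x y)%:E =
    \esum_(y in [set: X]) if y \in J then (p x y)%:E else 0)%E.
  rewrite (_ : esum _ _ =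
    \esum_(y in [set` J]) (p x y)%:E)%E; last first.
    by rewrite [RHS]esum_mkcond; apply: eq_esum => y _; rewrite mem_setE.
  rewrite esum_fset; [|exact: finite_fset|by move=> y _; rewrite lee_fin hp.1].
  by rewrite fsbig_finite ?set_fsetK//; exact: finite_fset.
rewrite -esumD; [|by move=> y _; case: ifP; rewrite // lee_fin hp.1
  |by move=> y _; rewrite lee_fin mulr_ge0 ?hp.1].
apply: le_esum => y _; case: ifPn => [/Jn|_].
  by rewrite ltnNge => /negbTE ->; rewrite mulr0 adde0.
by rewrite add0e lee_fin ler_piMr ?hp.1// lern1 leq_b1.
Qed.

Lemma tail_mass_cvg0 x e : 0 < e ->
  exists N, forall n, (N <= n)%N -> tail_mass n x < e.
Proof.
move=> e0; have [J Je] := fset_sum_approx_esum (hp.2 x) e0.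
exists (\max_(y <- J) (choice.pickle y).+1)%N => n Nn.
apply: (@le_lt_trans _ _ (1 - \sum_(y <- J) p x y)); last by rewrite ltrBlDr -ltrBlDl.
apply: tail_mass_le => y yJ; apply: leq_trans Nn.
exact: (@leq_bigmax_seq _ _ xpredT (fun y : X => (choice.pickle y).+1)).
Qed.

Lemma transition_tail n x :
  transition_operator emb p (tail_indicator n) x = emb (tail_mass n x).
Proof.
rewrite /transition_operator -(@sum_emb (fun y => p x y * (n <= choice.pickle y)%N%:R)).
- by congr summability.sum; apply/funext => y; rewrite rmorphM rmorph_nat.
- by move=> y; rewrite mulr_ge0 ?hp.1.
- exact: tail_massE.
Qed.

(** The images of the tail indicators lie in a compact set, so they have a
    uniform cluster point [h].  They tend to 0 pointwise, so [h] is 0, and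
    some image is uniformly below 1/2. *)
Lemma compact_operator_tight : compact_operator (transition_operator emb p) ->
  exists n, forall x, tail_mass n x <= 2^-1.
Proof.
move=> cT.
have [||C [cC _ TC]] := cT (range tail_indicator).
- move=> _ [n _ <-]; rewrite /linfty /bounded_near.
  near=> M => y _ /=; rewrite /tail_indicator.
  apply: (@le_trans _ _ 1); last by near: M; exact: nbhs_pinfty_ge.
  by case: leqP; rewrite ?normr0 ?normr1.
- exists 1 => _ [n _ <-] y; rewrite /tail_indicator.
  by case: leqP; rewrite ?normr0 ?normr1.
pose Tf n := transition_operator emb p (tail_indicator n).
have [|h [_ clh]] := cC (Tf @ \oo).
  by exists 0%N => // n _; apply: TC; exists (tail_indicator n) => //; exists n.
have h0 x : h x = 0.
  apply/eqP/negPn/negP => hx0.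
  have nhx : 0 < `|h x| / 2 by rewrite divr_gt0// normr_gt0.
  have [r r0 re] := emb_small nhx.
  have [N Nr] := tail_mass_cvg0 x r0.
  have [] := clh (Tf @` [set n | (N <= n)%N])
     [set g | `|h x - g x| < `|h x| / 2].
  - by exists N => // n /= Nn; exists n.
  - apply/uniform_nbhs; exists [set uv | `|uv.1 - uv.2| < `|h x| / 2]; split.
      rewrite -entourage_ballE; exists (`|h x| / 2) => //.
    by move=> g /= /(_ x I).
  move=> _ [[n /= Nn <-]] /=; rewrite /Tf transition_tail => hlt.
  have := ler_normD (h x - emb (tail_mass n x)) (emb (tail_mass n x)).
  (* The order of K may be partial: the contradiction is |h x| < |h x|, and
     not the negation of an inequality. *)
  rewrite subrK => /le_lt_trans => /(_ `|h x|).
  rewrite ltxx => /(_ _)/notF; apply.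
  rewrite [ltRHS](splitr `|h x|) ltrD// norm_emb ?tail_mass_ge0//.
  by apply: lt_le_trans re; rewrite (leW_mono emb_mono) Nr.
have [] := clh (range Tf) [set g | forall x, `|h x - g x| < emb 2^-1].
- by exists 0%N => // n _; exists n.
- apply/uniform_nbhs; exists [set uv | `|uv.1 - uv.2| < emb 2^-1]; split.
    rewrite -entourage_ballE; exists (emb 2^-1) => //.
    by rewrite /= -(rmorph0 emb) (leW_mono emb_mono) invr_gt0.
  by move=> g /= hg x; exact: hg.
move=> _ [[n _ <-]] /= hn; exists n => x; have := hn x.
rewrite h0 sub0r normrN /Tf transition_tail norm_emb ?tail_mass_ge0//.
by rewrite (leW_mono emb_mono) => /ltW.
Unshelve. all: by end_near. Qed.

End Tightness.

(** * Sums over countable types *)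

Section CountableSums.
Context (R : realType) (I : countType).
Local Open Scope ereal_scope.

Lemma measure_countable_bigcup (d : measure_display) (T : measurableType d)
    (mu : {measure set T -> \bar R}) (F : I -> set T) :
  (forall i, measurable (F i)) -> trivIset [set: I] F ->
  mu (\bigcup_i F i) = \esum_(i in [set: I]) mu (F i).
Proof.
move=> mF tF.
pose G n := if choice.unpickle n is Some i then F i else set0.
have GE i : G (choice.pickle i) = F i by rewrite /G choice.pickleK.
have pinj : set_inj [set: I] (@choice.pickle I).
  by move=> i j _ _; exact: (pcan_inj choice.pickleK).
have -> : \bigcup_i F i = \bigcup_(n in range (@choice.pickle I)) G n.
  by rewrite bigcup_image; apply: eq_bigcupr => i _; rewrite GE.
rewrite measure_bigcup.
- rewrite nneseries_esum// set_mem_set esum_image//.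
  by apply: eq_esum => i _; rewrite GE.
- by move=> _ [i _ <-]; rewrite GE.
- by move=> _ _ [i _ <-] [j _ <-]; rewrite !GE => /tF => ->.
Qed.

(** The factor may be infinite: the sum then vanishes or is infinite on both
    sides, according to whether all terms vanish. *)
Lemma esumZl (J : choiceType) (c : \bar R) (a : J -> \bar R) :
  0 <= c -> (forall j, 0 <= a j) ->
  \esum_(j in [set: J]) (c * a j) = c * \esum_(j in [set: J]) a j.
Proof.
move=> c0 a0; case: c c0 => [c| |//] c0; last first.
  have [/existsNP[j /eqP aj]|/contrapT aj] := pselect (~ forall j, a j = 0); last first.
    by rewrite !esum1 ?mule0// => j _; rewrite aj mule0.
  have aj0 : 0 < a j by rewrite lt_neqAle eq_sym aj a0.
  have lb (b : J -> \bar R) : (forall j, 0 <= b j) -> b j <= \esum_(i in [set: J]) b i.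
    move=> b0; rewrite -(esum_set1 (b0 j)) [leLHS]esum_mkcond.
    by apply: le_esum => i _; case: ifP.
  rewrite gt0_mulye; last exact: lt_le_trans (lb a a0).
  apply/eqP; rewrite -leye_eq -[leLHS](gt0_mulye aj0).
  by apply: (lb (fun j => +oo * a j)) => i; rewrite mule_ge0.
rewrite lee_fin in c0.
rewrite /esum -ereal_supZl//; last first.
  by apply/set0P; exists 0; exists set0; [exact: fsets_set0|rewrite fsbig_set0].
congr ereal_sup; rewrite image_comp; apply: eq_imagel => A /= _.
by rewrite ge0_mule_fsumr.
Qed.

Lemma exchange_esum (J : choiceType) (a : I -> J -> \bar R) :
  (forall i j, 0 <= a i j) ->
  \esum_(i in [set: I]) \esum_(j in [set: J]) a i j =
  \esum_(j in [set: J]) \esum_(i in [set: I]) a i j.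
Proof.
move=> a0; rewrite !esum_esum//.
rewrite (reindex_esum ([set: I] `*` [set: J]) _ (fun k => (k.2, k.1)))//.
split => //=.
- by move=> [i j] [k l] _ _ [-> ->].
- by move=> [j i] _; exists (i, j).
Qed.

End CountableSums.

(** * The Markov property and taboo probabilities *)

Section TabooProbabilities.
Context (R : realType) (X : countType).
Context (d : measure_display) (Omega : measurableType d).
Context (p : X -> X -> R) (Pr : X -> probability Omega R).
Context (Z : nat -> Omega -> X).
Hypothesis hwalk : random_walk p Pr Z.
Local Open Scope ereal_scope.

Let p_ge0 y z : (0 <= (p y z)%:E).
Proof. by rewrite lee_fin (walk_stochastic hwalk).1. Qed.

Definition trajectory (n : nat) (w : Omega) : seq X := mkseq (Z ^~ w) n.+1.

Lemma measurable_history n s : measurable (history Z n s).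
Proof.
rewrite (_ : history Z n s = \bigcap_(k in `I_n.+1) (Z k @^-1` [set s k])).
  by apply: bigcap_measurableType => k _; exact: (walk_measurable hwalk).
by apply/seteqP; split=> w /= H k; [move=> kn; apply: H|move=> kn; apply: H].
Qed.

(** The default value [b] of [nth] is never read at times up to [n], but
    [nth b s n.+1] is [b]: in [markov_past], this makes [nth b s] the path [s]
    prolonged by one step to [b]. *)
Lemma trajectory_eqP n (b : X) s w : size s = n.+1 ->
  trajectory n w = s <-> history Z n (nth b s) w.
Proof.
move=> sn; split => [<- k kn|H]; first by rewrite nth_mkseq.
apply: (@eq_from_nth _ b); first by rewrite size_mkseq.
by rewrite size_mkseq => k kn; rewrite nth_mkseq// H.
Qed.

Lemma measurable_trajectory n (C : set (seq X)) :
  measurable [set w | C (trajectory n w)].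
Proof.
have mtraj s : measurable [set w | trajectory n w = s].
  have [sn|sn] := pselect (size s = n.+1); last first.
    rewrite (_ : [set w | _] = set0)//; apply/seteqP; split => // w /= ws.
    by apply: sn; rewrite -ws size_mkseq.
  case: s sn => // b s sn.
  rewrite (_ : [set w | _] = history Z n (nth b (b :: s))).
    exact: measurable_history.
  by apply/seteqP; split => w /=; rewrite (trajectory_eqP b).
rewrite (_ : [set w | _] = \bigcup_(s in C) [set w | trajectory n w = s]).
  rewrite bigcup_mkcond; apply: countable_bigcupT_measurable => [|s]; first exact: countableP.
  by case: ifP.
by apply/seteqP; split => [w Cw|w [s Cs /= ->]//]; exists (trajectory n w).
Qed.

(** An event of the past is the countable disjoint union of the histories that
    it contains, so the Markov property extends to it by sigma-additivity. *)
Lemma markov_past (C : set (seq X)) y n z b :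
  Pr y [set w | [/\ C (trajectory n w), Z n w = z & Z n.+1 w = b]] =
  Pr y [set w | C (trajectory n w) /\ Z n w = z] * (p z b)%:E.
Proof.
pose D s := [/\ C s, size s = n.+1 & nth b s n = z].
pose F m s := [set w | D s /\ history Z m (nth b s) w].
have histS m s w : history Z m.+1 s w -> history Z m s w.
  by move=> H k km; apply: H; exact: leqW.
have mF m s : measurable (F m s).
  have [Ds|Ds] := pselect (D s).
    rewrite (_ : F m s = history Z m (nth b s)); first exact: measurable_history.
    by apply/seteqP; split => w // [].
  by rewrite (_ : F m s = set0)//; apply/seteqP; split => w // [].
have tF : trivIset setT (F n).
  move=> s t _ _ [w [[[_ sn _] /(trajectory_eqP _ _ sn) <-]]].
  by move=> [[_ tn _] /(trajectory_eqP _ _ tn) <-].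
have tF' : trivIset setT (F n.+1).
  move=> s t _ _ [w [[Ds hs] [Dt ht]]]; apply: tF => //.
  by exists w; split; split => //; exact: histS.
have DE w : C (trajectory n w) -> Z n w = z -> D (trajectory n w).
  by move=> Cw Zz; split => //; rewrite ?size_mkseq// nth_mkseq.
have -> : [set w | C (trajectory n w) /\ Z n w = z] = \bigcup_s F n s.
  apply/seteqP; split => [w [Cw Zz]|w [s _ [[Cs sn sz] hs]]] /=.
    exists (trajectory n w) => //; split; first exact: DE.
    by apply/trajectory_eqP => //; rewrite size_mkseq.
  move/(trajectory_eqP _ _ sn): (hs) => ->; split => //.
  by rewrite (hs n).
have -> : [set w | [/\ C (trajectory n w), Z n w = z & Z n.+1 w = b]] =
    \bigcup_s F n.+1 s.
  apply/seteqP; split => [w [Cw Zz Zb]|w [s _ [[Cs sn sz] hs]]] /=.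
    exists (trajectory n w) => //; split; first exact: DE.
    move=> k; rewrite leq_eqVlt => /predU1P[->|kn].
      by rewrite nth_default// size_mkseq.
    by rewrite nth_mkseq.
  move/(trajectory_eqP _ _ sn): (histS _ _ _ hs) => ->; split => //.
    by rewrite (hs n).
  by rewrite (hs n.+1)// nth_default// sn.
rewrite !measure_countable_bigcup// muleC -esumZl//.
apply: eq_esum => s _; have [[Cs sn sz]|Ds] := pselect (D s).
  have FE m : F m s = history Z m (nth b s).
    by apply/seteqP; split => w // [].
  have := walk_markov hwalk y n (nth b s).
  by rewrite !FE sz [nth b s n.+1]nth_default ?sn// muleC.
have F0 m : F m s = set0 by apply/seteqP; split => w // [].
by rewrite !F0 !measure0 mule0.
Qed.

Definition avoid (x : X) (n : nat) : set Omega :=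
  [set w | forall k, (0 < k <= n)%N -> Z k w <> x].

(** Time 0 is not constrained, whence [behead]. *)
Lemma avoid_trajectory x n :
  avoid x n = [set w | x \notin behead (trajectory n w)].
Proof.
apply/seteqP; split => w /= H.
  rewrite /trajectory /mkseq /=; apply/negP => /mapP[k].
  by rewrite mem_iota add1n ltnS => kn /esym; exact: H.
move=> k kn Zx; move/negP: H; apply; rewrite /trajectory /mkseq /=.
by apply/mapP; exists k => //; rewrite mem_iota add1n ltnS.
Qed.

Lemma measurable_avoid x n : measurable (avoid x n).
Proof.
rewrite avoid_trajectory.
exact: (measurable_trajectory n [set s | x \notin behead s]).
Qed.

(** The transition operator with the transitions into [x] removed. *)
Definition taboo_step (x : X) (f : X -> \bar R) (z : X) : \bar R :=
  \esum_(y in [set: X]) ((p z y)%:E * if y == x then 0 else f y).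

(** The distribution at time [n], started at [y], of the walk killed when it
    enters [x] after time 0. *)
Definition occupation (x y : X) (n : nat) (z : X) : \bar R :=
  Pr y (avoid x n `&` [set w | Z n w = z]).

Lemma taboo_step_ge0 x f z : (forall y, 0 <= f y) -> 0 <= taboo_step x f z.
Proof.
by move=> f0; apply: esum_ge0 => y _; rewrite mule_ge0//; case: ifP.
Qed.

(** The event is cut according to the state [z] at time [n]; each piece is an
    event of the past followed by a step from [z] to [b]. *)
Lemma occupationS x y n b : occupation x y n.+1 b =
  if b == x then 0 else
    \esum_(z in [set: X]) (occupation x y n z * (p z b)%:E).
Proof.
rewrite /occupation; case: eqP => [->|bx].
  rewrite (_ : _ `&` _ = set0)//; apply/seteqP; split => // w [+ /= Zx].
  by move=> /(_ n.+1); rewrite ltnS leqnn => /(_ isT).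
pose C := [set s : seq X | x \notin behead s].
pose E z := [set w | [/\ C (trajectory n w), Z n w = z & Z n.+1 w = b]].
have mE z : measurable (E z).
  pose C' := [set s : seq X | C (take n.+1 s) /\ nth b s n = z /\ nth z s n.+1 = b].
  rewrite (_ : E z = [set w | C' (trajectory n.+1 w)]); first exact: measurable_trajectory.
  have tk w : take n.+1 (trajectory n.+1 w) = trajectory n w.
    by rewrite /trajectory /mkseq -map_take take_iota (minn_idPl _).
  by apply/seteqP; split => w; rewrite /E /C' /mkset tk !nth_mkseq//; [case|case=> ? []].
have -> : avoid x n.+1 `&` [set w | Z n.+1 w = b] = \bigcup_z E z.
  have avE w : C (trajectory n w) = avoid x n w by rewrite avoid_trajectory.
  apply/seteqP; split => w /=.
    move=> [aw Zb]; exists (Z n w) => //; split => //; rewrite avE => k /andP[k0 kn].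
    by apply: aw; rewrite k0 leqW.
  move=> [z _ []]; rewrite avE => aw Zz Zb; split => // k /andP[k0].
  rewrite leq_eqVlt => /predU1P[->|kn]; first by rewrite Zb.
  by apply: aw; rewrite k0.
rewrite measure_countable_bigcup//; last first.
  by move=> z t _ _ [w [[_ <- _] [_ <- _]]].
apply: eq_esum => z _; apply: (etrans (markov_past C y n z b)).
by rewrite avoid_trajectory.
Qed.

(** Duality: a step forward of the distribution is a step of the operator on
    the test function, by exchange of the two sums.  The induction is on [n]
    for all [f] at once because the operator is applied first to [f]. *)
Lemma occupation_iter x y n f : (forall z, 0 <= f z) ->
  \esum_(z in [set: X]) (occupation x y n z * f z) = iter n (taboo_step x) f y.
Proof.
elim: n f => [f f0|n IH f f0] /=.
  have occ0 z : z != y -> occupation x y 0 z = 0.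
    move=> zy; apply/eqP; rewrite eq_le measure_ge0 andbT /=.
    have : Pr y (~` [set w | Z 0%N w = y]) = 0.
      rewrite probability_setC; last exact: (walk_measurable hwalk 0 [set y]).
      by rewrite (walk_start hwalk) subee.
    move=> <-; rewrite /occupation; apply: le_measure.
    - apply/mem_set; apply: measurableI; first exact: measurable_avoid.
      exact: (walk_measurable hwalk 0 [set z]).
    - by apply/mem_set; apply: measurableC; exact: (walk_measurable hwalk 0 [set y]).
    - by move=> w [_ /= ->]; apply/eqP.
  have occ1 : occupation x y 0 y = 1.
    rewrite /occupation (_ : avoid x 0 = setT) ?setTI; first exact: (walk_start hwalk).
    by apply/seteqP; split => // w _ k; rewrite leqn0 andbC => /andP[/eqP ->].
  rewrite -(esum_set1 (f0 y)).
  rewrite [RHS]esum_mkcond; apply: eq_esum => z _.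
  have [->|zy] := eqVneq z y; first by rewrite occ1 mul1e mem_set.
  by rewrite occ0// mul0e memNset//=; exact/eqP.
have occ_ge0 m z : 0 <= occupation x y m z by exact: measure_ge0.
rewrite -iterS iterSr -IH; last by move=> z; exact: taboo_step_ge0.
under [RHS]eq_esum => z _.
  rewrite -esumZl//; last by move=> b; rewrite mule_ge0//; case: ifP.
  over.
rewrite exchange_esum; last first.
  by move=> z b; rewrite !mule_ge0//; case: ifP.
apply: eq_esum => b _; rewrite occupationS; case: ifP => _.
  by rewrite mul0e esum1// => z _; rewrite !mule0.
rewrite muleC -esumZl//; last by move=> z; rewrite mule_ge0.
by apply: eq_esum => z _; rewrite muleC muleA.
Qed.

Lemma avoid_iter x y n : Pr y (avoid x n) = iter n (taboo_step x) (cst 1) y.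
Proof.
rewrite -occupation_iter//.
under eq_esum do rewrite mule1.
rewrite -measure_countable_bigcup//.
- by congr (Pr y _); apply/seteqP; split => [w aw|w [z _ []]//]; exists (Z n w).
- move=> z; apply: measurableI; first exact: measurable_avoid.
  exact: (walk_measurable hwalk n [set z]).
- by move=> z t _ _ [w [[_ <-] [_ <-]]].
Qed.



(** * Geometric decay of the avoidance probabilities *)

Lemma iter_taboo_ge0 x n f z : (forall y, 0 <= f y) ->
  0 <= iter n (taboo_step x) f z.
Proof.
by move=> f0; elim: n z => //= n IH z; exact: taboo_step_ge0.
Qed.

Lemma iter_taboo_le x n f g z : (forall y, f y <= g y) ->
  iter n (taboo_step x) f z <= iter n (taboo_step x) g z.
Proof.
move=> fg; elim: n z => //= n IH z; apply: le_esum => y _.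
by apply: lee_wpmul2l => //; case: ifP.
Qed.

Lemma iter_tabooZ x n c f z : 0 <= c -> (forall y, 0 <= f y) ->
  iter n (taboo_step x) (fun y => c * f y) z = c * iter n (taboo_step x) f z.
Proof.
move=> c0 f0; elim: n z => //= n IH z.
rewrite /taboo_step -esumZl//; last first.
  by move=> y; rewrite mule_ge0//; case: ifP => // _; exact: iter_taboo_ge0.
apply: eq_esum => y _; case: ifP => _; first by rewrite !mule0.
by rewrite IH muleCA.
Qed.

(** A bound [c] valid from all starting points says that the [L]-th iterate of
    the taboo operator sends 1 below the constant [c]; monotonicity and
    homogeneity multiply such bounds. *)
Lemma avoid_geometric x L k (c : R) z : (0 <= c)%R ->
  (forall y, Pr y (avoid x L) <= c%:E) ->
  Pr z (avoid x (L * k)) <= (c ^+ k)%:E.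
Proof.
move=> c0 Lc; rewrite avoid_iter; elim: k z => [|k IH] z.
  by rewrite muln0 expr0.
rewrite mulnS iterD; apply: le_trans (iter_taboo_le x L z IH) _.
rewrite (_ : (fun y : X => (c ^+ k)%:E) =
  fun y => (c ^+ k)%:E * (cst 1 y)); last first.
  by apply/funext => y; rewrite mule1.
rewrite iter_tabooZ ?lee_fin ?exprn_ge0// exprSr EFinM.
by apply: lee_wpmul2l; rewrite ?lee_fin ?exprn_ge0// -avoid_iter.
Qed.

Lemma avoid_anti x m n y : (m <= n)%N -> Pr y (avoid x n) <= Pr y (avoid x m).
Proof.
move=> mn; apply: le_measure.
- by apply/mem_set; exact: measurable_avoid.
- by apply/mem_set; exact: measurable_avoid.
- move=> w aw k /andP[k0 km]; apply: aw.
  by rewrite k0 (leq_trans km).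
Qed.

Hypothesis hirr : irreducible Pr Z.

(** Avoiding [x] during [n] steps excludes being at [x] at time [n].  Since [y]
    differs from [x], the time given by irreducibility is not 0. *)
Lemma avoid_lt1 x y : y <> x -> exists n (e : R), (0 < e)%R /\
  Pr y (avoid x n) <= (1 - e)%:E.
Proof.
move=> yx; have [n hn] := hirr y x.
have mZ m b : measurable [set w | Z m w = b] by exact: (walk_measurable hwalk m [set b]).
have fe : Pr y [set w | Z n w = x] \is a fin_num by exact: fin_num_measure.
exists n, (fine (Pr y [set w | Z n w = x])); split.
  by rewrite fine_gt0// hn ltey_eq fe.
rewrite EFinB fineK// -probability_setC//; apply: le_measure.
- by apply/mem_set; exact: measurable_avoid.
- by apply/mem_set; apply: measurableC.
move=> w aw /= Zx; apply: (aw n) Zx; rewrite leqnn andbT lt0n; apply/eqP => n0.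
move: hn; rewrite n0 ltNge => /negP; apply.
have -> : 0 = Pr y (~` [set w | Z 0%N w = y]).
  by rewrite probability_setC// (walk_start hwalk) subee.
apply: le_measure.
- exact/mem_set.
- by apply/mem_set; apply: measurableC.
- by move=> v /= -> xy; apply: yx.
Qed.

(** Over a finite set, the largest time and the smallest of the lower bounds
    serve for all points, since avoidance gets harder with time. *)
Lemma avoid_finite_lt1 x N : exists n (e : R), (0 < e <= 1)%R /\
  forall y, (choice.pickle y < N)%N -> y <> x -> Pr y (avoid x n) <= (1 - e)%:E.
Proof.
elim: N => [|N [n [e [/andP[e0 e1] IH]]]]; first by exists 0%N, 1%R; rewrite ltr01 lexx.
have [[y0 y0N y0x]|none] :=
  pselect (exists2 y0 : X, choice.pickle y0 = N & y0 <> x); last first.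
  exists n, e; rewrite e0 e1; split => // y; rewrite ltnS leq_eqVlt => /predU1P[yN yx|].
    by exfalso; apply: none; exists y.
  exact: IH.
have [m [r [r0 mr]]] := avoid_lt1 y0x.
exists (maxn n m), (Num.min e r); split.
  by rewrite lt_min e0 r0/= ge_min e1.
move=> y; rewrite ltnS leq_eqVlt => /predU1P[yN yx|yN yx].
  have -> : y = y0 by apply: (pcan_inj choice.pickleK); rewrite y0N.
  apply: le_trans (avoid_anti _ _ (leq_maxr n m)) (le_trans mr _).
  by rewrite lee_fin lerB// ge_min lexx orbT.
apply: le_trans (avoid_anti _ _ (leq_maxl n m)) (le_trans (IH _ yN yx) _).
by rewrite lee_fin lerB// ge_min lexx.
Qed.

(** Condition on the first step.  A step into the points of rank less than [N]
    either hits [x] or leads to a point from which [x] is avoided with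
    probability at most [1 - e]; a step elsewhere has probability at most 1/2
    and then costs at most [e] more.  This gives the bound
    [(1 - e) + e / 2]. *)
Lemma avoid_uniform x N : (forall z, (tail_mass p N z <= 2^-1)%R) ->
  exists n (c : R), (0 <= c < 1)%R /\ forall z, Pr z (avoid x n) <= c%:E.
Proof.
move=> hN; have [n [e [/andP[e0 e1] he]]] := avoid_finite_lt1 x N.
exists n.+1, (1 - e / 2)%R; split.
  by apply/andP; split; lra.
have st := walk_stochastic hwalk.
move=> z; rewrite avoid_iter iterS.
have step y : (p z y)%:E * (if y == x then 0 else iter n (taboo_step x) (cst 1) y) <=
    (1 - e)%:E * (p z y)%:E + e%:E * (p z y * (N <= choice.pickle y)%N%:R)%:E.
  rewrite -!EFinM -EFinD; case: eqP => [_|yx].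
    rewrite mule0 lee_fin addr_ge0 ?mulr_ge0 ?subr_ge0 ?st.1//; exact: ltW.
  rewrite -avoid_iter.
  case: leqP => Ny.
    rewrite mulr1 -mulrDl subrK mul1r -[leRHS]mule1.
    by apply: lee_wpmul2l => //; exact: probability_le1 (measurable_avoid x n).
  rewrite mulr0 mulr0 addr0 mulrC EFinM.
  by apply: lee_wpmul2l => //; exact: he.
apply: le_trans (le_esum (fun y _ => step y)) _.
rewrite esumD; first last.
- by move=> y _; rewrite mule_ge0// lee_fin ?mulr_ge0 ?st.1//; exact: ltW.
- by move=> y _; rewrite mule_ge0// lee_fin ?subr_ge0.
rewrite !esumZl ?lee_fin ?subr_ge0//; first last.
- by move=> y; rewrite lee_fin mulr_ge0 ?st.1.
- exact: ltW.
rewrite st.2 tail_massE// mule1 -EFinM -EFinD lee_fin.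
have := hN z; nra.
Qed.

(** Never returning to [x] implies avoiding [x] up to every time, which has
    probability at most [c ^+ k] for all [k]. *)
Lemma recurrent_of_tight N : (forall z, (tail_mass p N z <= 2^-1)%R) ->
  recurrent Pr Z.
Proof.
move=> hN x; have [n [c [/andP[c0 c1] hc]]] := avoid_uniform x hN.
set A := [set w | _].
have mA : measurable A.
  rewrite (_ : A = \bigcup_(k in [set k | (0 < k)%N]) [set w | Z k w = x]).
    by apply: bigcup_measurable => k _; exact: (walk_measurable hwalk k [set x]).
  by apply/seteqP; split => w [k]; [case=> k0 Zx; exists k|move=> k0 Zx; exists k].
have AC k : Pr x (~` A) <= (c ^+ k)%:E.
  apply: le_trans (avoid_geometric k x c0 hc); apply: le_measure.
  - by apply/mem_set; exact: measurableC.
  - by apply/mem_set; exact: measurable_avoid.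
  - by move=> w nA j /andP[j0 _] Zx; apply: nA; exists j.
have : Pr x (~` A) <= 0.
  apply/lee_addgt0Pr => e e0; rewrite add0e.
  have /(cvg_geometric 1) : (`|c| < 1)%R by rewrite ger0_norm.
  move=> /cvgrPdist_lt/(_ _ e0)[k _ /(_ k (leqnn k))].
  rewrite sub0r normrN /geometric /= mul1r => /(le_lt_trans (ler_norm _)) ce.
  by apply: le_trans (AC k) _; rewrite lee_fin ltW.
rewrite probability_setC// leeBlDr ?fin_num_measure// add0e => A1.
by apply/eqP; rewrite eq_le A1 andbT; exact: probability_le1.
Qed.

End TabooProbabilities.

Theorem proposition2p3 (R : realType) (X : countType)
    (d : measure_display) (Omega : measurableType d)
    (p : X -> X -> R) (Pr : X -> probability Omega R) (Z : nat -> Omega -> X)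
    (hwalk : random_walk p Pr Z)
    (hirr : irreducible Pr Z)
    (hcompact : compact_operator (transition_operator_real p) \/
                compact_operator (transition_operator_complex p)) :
  recurrent Pr Z.
Proof.
have hp := walk_stochastic hwalk.
suff [N hN] : exists N, forall z, tail_mass p N z <= 2^-1.
  exact: (recurrent_of_tight hwalk hirr hN).
case: hcompact => cT.
- apply: (@compact_operator_tight R X R idfun _ _ p hp cT) => //.
  by move=> e e0; exists e.
- (* A positive element of R[i] is real, hence equal to its real part. *)
  apply: (@compact_operator_tight R X R[i] (real_complex R) _ _ p hp cT).
    exact: lecR.
  move=> e; rewrite ltcE/= => /andP[/eqP e_im e0].
  by exists (complex.Re e) => //; rewrite lecE/= e_im eqxx lexx.
Qed.
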